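(* Suppose that $\theta\le\chi<\kappa$ are infinite, regular cardinals, $\kappa$ is $({<}\chi)$-inaccessible, and there is a closed and subadditive witness $c$ to $\mathrm{U}(\kappa,2,\theta,2)$. Then there is a sequence of posets $\langle\mathbb P_i\mid i<\theta\rangle$ such that: (1) for all $i<\theta$, $\mathbb P_i$ is well-met and $\chi$-directed closed with greatest lower bounds; (2) for all $j<\theta$, $\prod_{i<j}\mathbb P_i$ is $\kappa$-stationarily layered; (3) $\prod_{i<\theta}\mathbb P_i$ is not $\kappa$-cc. If, in addition, $\partial(c)\cap E^\kappa_\chi$ is stationary, then the sequence $\langle\mathbb P_i\mid i<\theta\rangle$ can be made constant.
   Context: $\kappa$ is $({<}\chi)$-inaccessible if $\nu^\mu<\kappa$ for all $\nu<\kappa$ and $\mu<\chi$. $E^\kappa_\chi=\{\alpha<\kappa\mid\mathrm{cf}(\alpha)=\chi\}$. For a set $a$ of ordinals: $\mathrm{ssup}(a)=\sup\{\alpha+1\mid\alpha\in a\}$, $\mathrm{acc}^+(a)=\{\alpha<\mathrm{ssup}(a)\mid \sup(a\cap\alpha)=\alpha>0\}$, $\mathrm{acc}(a)=a\cap\mathrm{acc}^+(a)$. For sets of ordinals, $a<b$ means every element of $a$ is below every element of $b$. For $c:[\kappa]^2\to\theta$ write $c(\alpha,\beta)$ for $c(\{\alpha,\beta\})$, $\alpha<\beta$. $\mathrm{U}(\kappa,\mu,\theta,\chi)$: a coloring $c:[\kappa]^2\to\theta$ witnesses it if for every $\sigma<\chi$, every pairwise disjoint $\mathcal A\subseteq[\kappa]^\sigma$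 with $|\mathcal A|=\kappa$, and every $i<\theta$, there is $\mathcal B\subseteq\mathcal A$ with $|\mathcal B|=\mu$ such that $\min(c[a\times b])>i$ for all $a,b\in\mathcal B$ with $a<b$. $c$ is subadditive if for all $\alpha<\beta<\gamma<\kappa$: $c(\alpha,\gamma)\le\max\{c(\alpha,\beta),c(\beta,\gamma)\}$ and $c(\alpha,\beta)\le\max\{c(\alpha,\gamma),c(\beta,\gamma)\}$. With $D^c_{\le i}(\beta)=\{\alpha<\beta\mid c(\alpha,\beta)\le i\}$, $c$ is closed if $\mathrm{acc}^+(D^c_{\le i}(\beta))\subseteq D^c_{\le i}(\beta)$ for all $\beta<\kappa$, $i\le\theta$; and $\partial(c)=\{\beta\in\mathrm{acc}(\kappa)\mid\forall\gamma<\kappa\,\forall i<\theta\ \sup(D^c_{\le i}(\gamma)\cap\beta)<\beta\}$. Posets: products are full-support products with the coordinatewise order. A poset is well-met if any two compatible conditions have a greatest lower bound; it is $\chi$-directed closed with greatest lower bounds if every directed subset of size $<\chi$ has a greatest lower bound. A suborder $\mathbb Q\subseteq\mathbb P$ is regular if incompatible conditions of $\mathbb Q$ are incompatible in $\mathbb P$ and every maximal antichain of $\mathbb Q$ is a maximal antichain of $\mathbb P$. $\mathbb P$ is $\kappa$-stationarily layered if the collection of regular suborders of $\mathbb P$ of size less than $\kappa$ is stationary in $\mathcal P_\kappa(\mathbb P)$ (the subsets of $\mathbb P$ of size $<\kappa$). $\mathbb P$ is $\kappa$-cc if it has no antichain of size $\kappa$. *)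

(* Defs.v *)
From HB Require Import structures.
From mathcomp Require Import all_boot all_order.
From mathcomp Require Import boolp classical_sets functions cardinality.

Set Implicit Arguments.
Unset Strict Implicit.
Unset Printing Implicit Defensive.

Import Order.TTheory.

Local Open Scope classical_set_scope.
Local Open Scope card_scope.
Local Open Scope order_scope.

Definition card_lt (T U : Type) (A : set T) (B : set U) : Prop :=
  A #<= B /\ ~ (B #<= A).

(* Ordinals are elements of an ambient well-ordered type [O].  The ordinal [a]
   is identified with its set of predecessors [below a]; a set of size [a] is
   a set equipotent to [below a].  Every ordinal kappa is of this form, e.g.
   with O = kappa + 1. *)
Section Ordinals.
Context {d : Order.disp_t} {O : orderType d}.
Implicit Types (a b k th ch mu : O) (A C E x y : set O) (c : O -> O -> O).

Definition below a : set O := [set b | b < a].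

Definition is_nat_ordinal a (n : nat) : Prop := below a #= `I_n.

Definition ssups A : set O :=
  [set s | (forall a, A a -> a < s) /\
           (forall t, (forall a, A a -> a < t) -> s <= t)].

(* The suprema of [set0] consist of the ordinal zero. *)
Definition accp A : set O :=
  [set a | (exists2 s, ssups A s & a < s) /\
           supremums (A `&` below a) a /\ below a !=set0].

Definition acc A : set O := A `&` accp A.

Definition sup_below A b : Prop := exists2 s, supremums A s & s < b.

Definition cofinal_map b a : Prop :=
  exists f : O -> O, (forall e, e < b -> f e < a) /\
    (forall g, g < a -> exists2 e, e < b & g <= f e).

Definition is_cof a b : Prop :=
  cofinal_map b a /\ forall b', cofinal_map b' a -> b <= b'.

Definition is_cardinal a : Prop :=
  forall b, b < a -> card_lt (below b) (below a).

Definition infinite_regular a : Prop :=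
  [/\ infinite_set (below a), is_cardinal a & is_cof a a].

Definition lt_inaccessible ch k : Prop :=
  forall n m, n < k -> m < ch ->
    card_lt [set: {e : O | e < m} -> {e : O | e < n}] (below k).

Definition cof_set k ch : set O := [set a | a < k /\ is_cof a ch].

Definition club k C : Prop :=
  [/\ C `<=` below k, (forall a, a < k -> exists2 b, C b & a < b) &
      forall a, a < k -> accp C a -> C a].

Definition stationary k E : Prop :=
  forall C, club k C -> (C `&` E) !=set0.

(* Only the values c a b with a < b < k are relevant: c stands for the
   coloring {a, b} |-> c a b. *)
Definition coloring k th c : Prop :=
  forall a b, a < b -> b < k -> c a b < th.

Definition subsets_of_size k s : set (set O) :=
  [set x | x `<=` below k /\ x #= below s].

Definition set_before x y : Prop := forall a b, x a -> y b -> a < b.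

Definition U_witness k mu th ch c : Prop :=
  coloring k th c /\
  forall (s : O) (AA : set (set O)) (i : O), s < ch ->
    AA `<=` subsets_of_size k s -> trivIset AA id -> AA #= below k ->
    i < th ->
    exists BB : set (set O), [/\ BB `<=` AA, BB #= below mu &
      forall x y, BB x -> BB y -> set_before x y ->
        forall a b, x a -> y b -> i < c a b].

Definition subadditive k c : Prop :=
  forall a b g, a < b -> b < g -> g < k ->
    c a g <= Order.max (c a b) (c b g) /\
    c a b <= Order.max (c a g) (c b g).

Definition Dle c i b : set O := [set a | a < b /\ c a b <= i].

Definition closed_coloring k th c : Prop :=
  forall b i, b < k -> i <= th -> accp (Dle c i b) `<=` Dle c i b.

Definition partial k th c : set O :=
  [set b | acc (below k) b /\
     forall g i, g < k -> i < th -> sup_below (Dle c i g `&` below b) b].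

(* The subsets of X of size less than k. *)
Definition Psub k {X : Type} : set (set X) :=
  [set Y | card_lt Y (below k)].

Definition club_Psub k (X : Type) (CC : set (set X)) : Prop :=
  [/\ CC `<=` Psub k,
      (forall Y, Psub k Y -> exists2 Z, CC Z & Y `<=` Z) &
      forall (l : O) (Y : O -> set X), l < k -> below l !=set0 ->
        (forall e, e < l -> CC (Y e)) ->
        (forall e e', e <= e' -> e' < l -> Y e `<=` Y e') ->
        CC (\bigcup_(e in below l) Y e)].

Definition stationary_Psub k (X : Type) (SS : set (set X)) : Prop :=
  SS `<=` Psub k /\ forall CC, club_Psub k CC -> (CC `&` SS) !=set0.

End Ordinals.

Section Posets.
Context {dp : Order.disp_t} {P : porderType dp}.
Implicit Types (p q r : P) (A Q D : set P).

(* Compatibility inside the suborder Q, that is, with a witness in Q. *)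
Definition compatible Q p q : Prop :=
  exists r, [/\ Q r, r <= p & r <= q].

Definition antichain Q A : Prop :=
  A `<=` Q /\ forall p q, A p -> A q -> p <> q -> ~ compatible Q p q.

Definition maximal_antichain Q A : Prop :=
  antichain Q A /\ forall B, antichain Q B -> A `<=` B -> B = A.

Definition regular_suborder Q : Prop :=
  (forall p q, Q p -> Q q -> ~ compatible Q p q -> ~ compatible setT p q) /\
  (forall A, maximal_antichain Q A -> maximal_antichain setT A).

Definition directed D : Prop :=
  D !=set0 /\
  forall p q, D p -> D q -> exists r, [/\ D r, r <= p & r <= q].

End Posets.

Definition well_met {dp} (P : porderType dp) : Prop :=
  forall p q : P, compatible setT p q -> infimums [set p; q] !=set0.

Definition directed_closed_glb {d} {O : orderType d} (ch : O)
    {dp} (P : porderType dp) : Prop :=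
  forall D : set P, directed D -> card_lt D (below ch) -> infimums D !=set0.

Definition stationarily_layered {d} {O : orderType d} (k : O)
    {dp} (P : porderType dp) : Prop :=
  stationary_Psub k
    [set Q : set P | regular_suborder Q /\ card_lt Q (below k)].

Definition has_cc {d} {O : orderType d} (k : O)
    {dp} (P : porderType dp) : Prop :=
  ~ exists A : set P, antichain setT A /\ A #= below k.

Definition full_product {dp} {I : Type} (P : I -> porderType dp) : Type :=
  forall i, P i.

Section FullProduct.
Context {dp : Order.disp_t} {I : Type} (P : I -> porderType dp).
Implicit Types f g h : full_product P.

HB.instance Definition _ := Choice.copy (full_product P) (forall i, P i).

Definition product_le f g : bool := `[< forall i, f i <= g i >].

Fact product_le_refl : reflexive product_le.
Proof. by move=> f; apply/asboolP => i. Qed.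

Fact product_le_anti : antisymmetric product_le.
Proof.
move=> f g /andP[/asboolP fg /asboolP gf].
by apply: functional_extensionality_dep => i; apply/le_anti; rewrite fg gf.
Qed.

Fact product_le_trans : transitive product_le.
Proof.
move=> g f h /asboolP fg /asboolP gh.
by apply/asboolP => i; apply: le_trans (gh i).
Qed.

HB.instance Definition _ := Order.Le_isPOrder.Build dp (full_product P)
  product_le_refl product_le_anti product_le_trans.

End FullProduct.

(* The product of the posets P i over all i < j. *)
Definition product_below {d} {O : orderType d} {dp} (P : O -> porderType dp)
    (j : O) : porderType dp :=
  full_product (fun i : {i : O | i < j} => P (sval i)).

(* The sequence is P restricted to the indices below th. *)
Definition layered_sequence {d} {O : orderType d} (k th ch : O)
    {dp} (P : O -> porderType dp) : Prop :=
  [/\ (forall i, i < th -> well_met (P i) /\ directed_closed_glb ch (P i)),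
      (forall j, j < th -> stationarily_layered k (product_below P j)) &
      ~ has_cc k (product_below P th)].

(* Main.v *)
Require Import Defs.
From HB Require Import structures.
From mathcomp Require Import all_boot all_order.
From mathcomp Require Import boolp classical_sets functions cardinality.

Import Order.TTheory.

Local Open Scope classical_set_scope.
Local Open Scope card_scope.
Local Open Scope order_scope.

(** Fix a function [h] on [kappa] and call a set [m]-homogeneous if
    [m < max (c a b) (h b)] for all [a < b] in it.  The [i]-th poset consists
    of the [i]-homogeneous subsets of [kappa] of size less than [chi], ordered
    by reverse inclusion.  Greatest lower bounds are unions, by regularity of
    [chi].  The constant sequence of conditions [{a}], for [a < kappa], gives an
    antichain of the full product: [{a}] and [{b}] are incompatible at the
    coordinate [max (c a b) (h b)] ([product_not_cc]).

    Layering.  Let [supported e] be the set of conditions of a product of fewer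
    than [theta] of the posets all of whose coordinates are subsets of [e].  It
    has size less than [kappa] by inaccessibility ([few_supported]), and the
    sets [supported e] with [cf e = chi] exhaust the product continuously, so
    it is enough to find stationary many [e] for which [supported e] is a
    regular suborder.  Suppose that [e] is closed under a function reflecting
    statements about small sets, and that for [b >= e] and the labels [m] that
    occur the ordinals [a < e] with [c a b, h b <= m] are bounded in [e].  They
    then have a maximum [g], and by subadditivity [a <= g] is one of them
    exactly when [a = g] or [c a g <= m].  So reflecting a condition [x] to some
    [x'] below [e] only takes the information [x] restricted to [e] and the
    fewer than [chi] maxima [g]; the reflection is a reduction of [x]
    ([condition_reduction]).

    The role of [h].  A bounded set [{a < b | c a b <= m}] may lack a maximum
    even though [c] is closed, since closedness concerns limits below the
    strict supremum only.  If [c b b' <= m] for some [b' > b], then [b] itself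
    belongs to the corresponding set of [b'], and the maximum exists
    ([color_limit], [bounded_max]).  Taking [h b >= c b b'] for a chosen [b']
    makes the sets without a maximum irrelevant.

    Boundedness.  If [partial c] meets the ordinals of cofinality [chi] in a
    stationary set, boundedness holds there for all labels at once, so that the
    disjoint union of all the posets can be used at every coordinate.  In
    general there is [b0] such that, for each [j < theta], stationary many [e]
    of cofinality [chi] satisfy [j < c b0 e] ([ex_large_color]): otherwise every
    [b] has a color bounding [c b e] for club many of these [e], one such color
    serves [kappa] many [b], and subadditivity bounds [c] on these, contrary to
    the unboundedness of [c].  Now let also [h b >= c b0 b] for [b > b0].  If
    [h b <= i < j < c b0 e] and the set of [a < e] with [c a b <= i] were
    unbounded in [e], closedness would give [c e b' <= i], whence
    [c b0 e <= i]. *)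

(** * Cardinality of sets *)

Lemma inj_on_card_le {T U : Type} {A : set T} {B : set U} (f : T -> U) :
  set_fun A B f -> set_inj A f -> A #<= B.
Proof.
move=> fAB fI; have [g] : $|{injfun A >-> B}| by apply/injfunPex; exists f.
exact: inj_card_le.
Qed.

Lemma card_le_inj_on {T U : Type} {A : set T} {B : set U} (u : U) :
  A #<= B -> exists2 f : T -> U, set_fun A B f & set_inj A f.
Proof.
elim/Ppointed: U => U in B u *; first by case: (no u).
by move=> /pcard_leP[f]; apply/injfunPex; squash f.
Qed.

Section WellOrder.
Context {d : Order.disp_t} {O : orderType d}.
Hypothesis wfO : well_founded (fun a b : O => a < b).

Lemma ex_least (A : set O) :
  A !=set0 -> exists2 a, A a & forall b, A b -> a <= b.
Proof.
move=> [a]; elim/(well_founded_ind wfO): a => a IH Aa.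
have [[b [Ab ba]]|noless] := pselect (exists b, A b /\ b < a).
  exact: IH ba Ab.
by exists a => // b Ab; rewrite leNgt; apply/negP => ba; apply: noless; exists b.
Qed.

Lemma wf_recursion {T : Type} (step : forall a : O, (forall b, b < a -> T) -> T) :
  exists F : O -> T, forall a, F a = step a (fun b _ => F b).
Proof.
exists (Fix wfO (fun _ => T) step) => a; rewrite Fix_eq//.
move=> b f g fg; congr step.
by apply: functional_extensionality_dep => e;
   apply: functional_extensionality_dep => eb.
Qed.

Definition few (k : O) {T : Type} (X : set T) : Prop :=
  exists2 e, e < k & X #<= below e.

Lemma few_le {k : O} {T U : Type} {X : set T} {Y : set U} :
  few k X -> Y #<= X -> few k Y.
Proof. by move=> [e ek Xe] YX; exists e => //; exact: card_le_trans YX Xe. Qed.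

Lemma few_sub {k : O} {T : Type} {X Y : set T} :
  few k X -> Y `<=` X -> few k Y.
Proof. by move=> /few_le XY /subset_card_le; exact: XY. Qed.

Lemma few_image {k : O} {T U : Type} {X : set T} (f : T -> U) :
  few k X -> few k (f @` X).
Proof. by move=> /few_le; apply; exact: card_image_le. Qed.

Lemma few_below {k e : O} : e < k -> few k (below e).
Proof. by move=> ek; exists e. Qed.

Lemma few_mono {k k' : O} {T : Type} {X : set T} : k <= k' -> few k X -> few k' X.
Proof. by move=> kk' [e ek Xe]; exists e => //; exact: lt_le_trans ek kk'. Qed.

(** Elements of [X] are listed along the ordinals until none is left, which
    happens before [k] or not at all below [k]. *)
Lemma card_dichotomy (k : O) {T : Type} (X : set T) :
  (below k #<= X) \/ few k X.
Proof.
elim/Pchoice: T => T in X *.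
pose fresh (a : O) (prev : forall b, b < a -> option T) :=
  [set t | X t /\ forall b (ba : b < a), prev b ba <> Some t].
have [F FE] := @wf_recursion (option T) (fun a prev =>
  if pselect (fresh a prev !=set0) is left ne then Some (projT1 (cid ne))
  else None).
have FX a t : F a = Some t -> X t /\ forall b, b < a -> F b <> Some t.
  by rewrite FE; case: pselect => // ne [<-]; case: (cid ne).
have [[a [ak Fa]]|all_some] := pselect (exists a, a < k /\ F a = None).
- right; exists a => //.
  suff : some @` X #<= below a by rewrite card_ge_some.
  apply: card_le_trans (card_image_le F (below a)); apply: subset_card_le.
  move=> _ [t Xt <-]; apply: contrapT => Nt.
  move: Fa; rewrite FE; case: pselect => // Nfresh _; apply: Nfresh.
  by exists t; split=> // b ba Fb; apply: Nt; exists b.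
- left; have FS a : below k a -> exists t, F a = Some t.
    move=> ak; case Fa: (F a) => [t|]; first by exists t.
    by case: all_some; exists a.
  suff : below k #<= some @` X by rewrite card_le_some.
  apply: (inj_on_card_le F).
    by move=> a /FS[t Fa]; exists t => //; case: (FX _ _ Fa).
  move=> a b; rewrite !inE => /FS[t Fa] /FS[u Fb]; rewrite Fa Fb => -[tu].
  subst u; case: (ltgtP a b) => // ab.
    by case: (FX _ _ Fb) => _ /(_ _ ab).
  by case: (FX _ _ Fa) => _ /(_ _ ab).
Qed.

Lemma few_card_lt {k : O} {T : Type} {X : set T} :
  is_cardinal k -> few k X <-> card_lt X (below k).
Proof.
move=> ck; split=> [[e ek Xe]|[_ NkX]].
  have [ek1 ek2] := ck _ ek; split; first exact: card_le_trans Xe ek1.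
  by move=> kX; apply: ek2; exact: card_le_trans kX Xe.
by case: (card_dichotomy k X).
Qed.

Lemma infinite_few_finite {k : O} {T : Type} {X : set T} :
  infinite_set (below k) -> finite_set X -> few k X.
Proof.
move=> ik fX; case: (card_dichotomy k X) => // kX.
by case: ik; exact: card_le_finite kX fX.
Qed.

(** * Cofinality and regular cardinals *)

Lemma cof_bound {k ch : O} {T : Type} {X : set T} (f : T -> O) :
  is_cof k ch -> few ch X -> (forall x, X x -> f x < k) ->
  exists2 b, b < k & forall x, X x -> f x < b.
Proof.
move=> [[h [hk hcof]] cmin] [e ech Xe] fk.
have [->|/set0P[x0 Xx0]] := eqVneq X set0.
  (* For empty [X] the bound is any element below [k]. *)
  by exists (h e) => [|x []//]; exact: hk.
have [phi phiX phiI] := card_le_inj_on e Xe.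
pose g a := if pselect (exists2 x, X x & phi x = a) is left ne
            then f (projT1 (cid2 ne)) else f x0.
have gk a : g a < k.
  by rewrite /g; case: pselect => [ne|_]; [case: (cid2 ne) => x /= /fk|exact: fk].
apply: contrapT => Nb; suff : ch <= e by rewrite leNgt ech.
apply: cmin; exists g; split=> [//|b bk].
apply: contrapT => Ng; apply: Nb; exists b => // x Xx.
rewrite ltNge; apply/negP => bx; apply: Ng; exists (phi x); first exact: phiX.
rewrite /g; case: pselect => [ne|[]]; last by exists x.
case: (cid2 ne) => y Xy /= phixy.
by rewrite (phiI _ _ _ _ phixy) ?inE.
Qed.

(** The argument maps [k] into the union and uses regularity twice, which avoids
    the arithmetic of products of cardinals. *)
Lemma regular_few_union {k : O} {T J : Type} {D : set J} {F : J -> set T} :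
  infinite_regular k -> few k D -> (forall j, D j -> few k (F j)) ->
  few k (\bigcup_(j in D) F j).
Proof.
move=> [_ _ rk] fD fF; case: (card_dichotomy k (\bigcup_(j in D) F j)) => // kU.
have [t0|NT] := pselect (\bigcup_(j in D) F j !=set0); last first.
  apply: few_le fD _; rewrite (_ : \bigcup_(j in D) F j = set0) ?card_ge0//.
  by apply/eqP/negPn/negP => /set0P.
have [g gU gI] := card_le_inj_on (projT1 (cid t0)) kU.
(* [k] is covered by few fibres, each bounded in [k]; so it is bounded in
   itself. *)
pose fib j := [set a | a < k /\ F j (g a)].
have fib_bound j : exists b, D j -> b < k /\ forall a, fib j a -> a < b.
  have [Dj|] := pselect (D j); last by exists k.
  have /(cof_bound id rk) : few k (fib j).
    apply: few_le (fF _ Dj) _; apply: (inj_on_card_le g).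
      by move=> a [].
    by move=> a b; rewrite !inE => -[ak _] [bk _]; apply: gI; rewrite inE.
  by move=> []//; [by move=> a []|move=> b bk H; exists b].
have [B BP] := choice fib_bound.
have [] := cof_bound B rk fD; first by move=> j /BP[].
move=> b bk Bb; have [j Dj Fj] := gU b bk.
have [_ /(_ b (conj bk Fj)) bB] := BP j Dj.
by have := lt_trans bB (Bb j Dj); rewrite ltxx.
Qed.

Lemma regular_few_setU {k : O} {T : Type} {X Y : set T} :
  infinite_regular k -> few k X -> few k Y -> few k (X `|` Y).
Proof.
move=> rk fX fY; have [ik _ _] := rk.
rewrite (_ : (X `|` Y)%classic = \bigcup_(b in [set: bool]) (if b then X else Y)).
  apply: regular_few_union => //; last by case.
  exact: infinite_few_finite (finite_finset).
apply/seteqP; split=> [t [?|?]|t [[] _]]; by [exists true|exists false|left|right].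
Qed.

Lemma regular_unbounded {k : O} : infinite_regular k ->
  forall a, a < k -> exists2 b, b < k & a < b.
Proof.
move=> [ik _ rk] a ak.
have [|_ -> |b bk ab] := @cof_bound _ _ _ [set a] id rk.
- exact: infinite_few_finite (finite_set1 _).
- by [].
- by exists b => //; exact: ab.
Qed.

(** * Limit points and stationary sets *)

Lemma accp_cofinal {A : set O} {a : O} :
  accp A a -> forall e, e < a -> exists b, [/\ A b, e < b & b < a].
Proof.
move=> [_ [[_ amin] _]] e ea; apply: contrapT => Nb.
suff : ubound (A `&` below a) e by move/amin; rewrite leNgt ea.
move=> b [Ab ba]; rewrite leNgt; apply/negP => eb; apply: Nb; by exists b.
Qed.

(** The points of [acc^+(A)] lie below the strict supremum of [A]: a bounded
    set need not contain its supremum in order to be closed. *)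
Lemma cofinal_accp {A : set O} {a b s : O} :
  (forall e, A e -> e < s) -> A b -> a <= b -> below a !=set0 ->
  (forall e, e < a -> exists e', [/\ A e', e < e' & e' < a]) -> accp A a.
Proof.
move=> As Ab ab a0 Acof; split; last split=> //.
  have [t tub tmin] := ex_least [set t | forall e, A e -> e < t]
    (ex_intro _ s As).
  by exists t => //; exact: le_lt_trans ab (tub _ Ab).
split=> [e [_ ea]|t tub]; first exact: ltW.
rewrite leNgt; apply/negP => /Acof[e [Ae te ea]].
by have := tub e (conj Ae ea); rewrite leNgt te.
Qed.

Definition closed_under (g : O -> O) (a : O) : Prop :=
  below a !=set0 /\ forall b, b < a -> g b < a.

Lemma closed_under_max {g h : O -> O} {a : O} :
  closed_under (fun b => Order.max (g b) (h b)) a ->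
  closed_under g a /\ closed_under h a.
Proof.
move=> [a0 gh]; do 2 split=> //; move=> b /gh.
all: by rewrite gt_max => /andP[].
Qed.

(** The supremum of an increasing [ch]-sequence each of whose terms exceeds
    the values of [g] on the ordinals up to the earlier terms. *)
Lemma ex_closed_under {k ch : O} {g : O -> O} {a0 : O} :
  infinite_regular k -> infinite_regular ch -> ch < k ->
  (forall a, a < k -> g a < k) -> a0 < k ->
  exists a, [/\ a < k, a0 < a, is_cof a ch & closed_under g a].
Proof.
move=> rk rch chk gk a0k; have [_ _ cofk] := rk; have [ich _ cofch] := rch.
have /choice[G GP] : forall a, exists b, a < k ->
    [/\ b < k, a < b & forall z, z <= a -> g z < b].
  move=> a; have [ak|] := pselect (a < k); last by exists a.
  have [a' a'k aa'] := regular_unbounded rk _ ak.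
  have [|b bk gb] := cof_bound g cofk (few_below a'k).
    by move=> x xa'; exact/gk/(lt_trans xa').
  exists (Order.max a' b) => _; split.
  - by rewrite gt_max a'k.
  - by rewrite lt_max aa'.
  - by move=> z za; rewrite lt_max gb ?orbT//; exact: le_lt_trans za aa'.
pose good (a : O) (prev : forall e, e < a -> O) := [set b | [/\ b < k, a0 < b &
  forall e (ea : e < a), G (prev e ea) < b]].
have [s sE] := wf_recursion (fun a prev => xget k (good a prev)).
have sP a : a < ch -> good a (fun e _ => s e) (s a).
  elim/(well_founded_ind wfO): a => a IH ach.
  rewrite sE; apply: xgetPex.
  have [|b bk Gb] := cof_bound (fun e => G (s e)) cofk
      (few_below (lt_trans ach chk)).
    by move=> e ea; have [sk _ _] := IH e ea (lt_trans ea ach); have [] := GP _ sk.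
  have [a1 a1k a01] := regular_unbounded rk _ a0k.
  exists (Order.max a1 b); split; first by rewrite gt_max a1k.
    by rewrite lt_max a01.
  by move=> e ea; rewrite lt_max (Gb e ea) orbT.
have sk a : a < ch -> s a < k by move=> /sP[].
have sG e a : e < a -> a < ch -> G (s e) < s a.
  by move=> ea /sP[_ _]; exact.
have smono e a : e < a -> a < ch -> s e < s a.
  move=> ea ach; apply: lt_trans (sG _ _ ea ach).
  by have [] := GP _ (sk _ (lt_trans ea ach)).
have [B Bk sB] := cof_bound s cofk (few_below chk) sk.
have [a aub amin] := ex_least [set t | forall e, e < ch -> s e < t]
  (ex_intro _ B sB).
have acof z : z < a -> exists2 e, e < ch & z <= s e.
  move=> za; apply: contrapT => Ne; suff : a <= z by rewrite leNgt za.
  apply: amin => e ech; rewrite ltNge; apply/negP => zs.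
  by apply: Ne; exists e.
have [o och] := infinite_setN0 ich.
exists a; split.
- exact: le_lt_trans (amin _ sB) Bk.
- by apply: lt_trans (aub _ och); case: (sP _ och).
- split; first by exists s.
  move=> b [f [fa fcof]]; rewrite leNgt; apply/negP => bch.
  have /choice[h hP] : forall e, exists e', e < b -> e' < ch /\ f e <= s e'.
    move=> e; have [eb|] := pselect (e < b); last by exists b.
    by have [e' ? ?] := acof _ (fa _ eb); exists e'.
  have [|b' b'ch hb'] := cof_bound h cofch (few_below bch).
    by move=> e /hP[].
  have [e eb sfe] := fcof _ (aub _ b'ch).
  have [_ fse] := hP _ eb; have := smono _ _ (hb' _ eb) b'ch.
  by rewrite ltNge (le_trans sfe fse).
- split; first by exists (s o); exact: aub.
  move=> z /acof[e ech ze]; have [e' e'ch ee'] := regular_unbounded rch _ ech.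
  apply: lt_trans (aub _ e'ch); apply: lt_trans (sG _ _ ee' e'ch).
  by have [_ _] := GP _ (sk _ ech); exact.
Qed.

Lemma stationary_closed_under {k ch : O} {E : set O} {g : O -> O} :
  infinite_regular k -> infinite_regular ch -> ch < k -> stationary k E ->
  (forall a, a < k -> g a < k) -> exists a, [/\ E a, a < k & closed_under g a].
Proof.
move=> rk rch chk sE gk.
have [|a [[ak ga] Ea]] := sE [set a | a < k /\ closed_under g a];
  last by exists a.
split=> [a []//|a ak|a ak aacc].
  by have [b [bk ab _ bg]] := ex_closed_under rk rch chk gk ak; exists b.
split=> //; have [_ [_ a0]] := aacc; split=> // e ea.
have [b [[_ [_ gb]] eb ba]] := accp_cofinal aacc _ ea.
exact: lt_trans (gb _ eb) ba.
Qed.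

(** * Counting small sets *)

Definition small_subsets (ch a : O) : set (set O) :=
  [set x | x `<=` below a /\ few ch x].

Lemma few_functions {k ch j : O} {U : Type} {B : set U} :
  infinite_regular k -> lt_inaccessible ch k -> j < ch -> few k B ->
  few k [set f : {i : O | i < j} -> U | forall i, B (f i)].
Proof.
move=> rk inacc jch [n nk Bn]; have [_ ck _] := rk.
have [n' n'k nn'] := regular_unbounded rk _ nk.
have [psi psiB psiI] := card_le_inj_on n Bn.
have [m mk fm] : few k [set: {e : O | e < j} -> {e : O | e < n'}].
  by apply/(few_card_lt ck); exact: inacc.
have psi_lt u : (if pselect (B u) then psi u else n) < n'.
  by case: pselect => // Bu; exact: lt_trans (psiB _ Bu) nn'.
exists m => //; apply: card_le_trans fm.
pose code (f : {i : O | i < j} -> U) i : {e : O | e < n'} :=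
  exist (fun e => e < n') _ (psi_lt (f i)).
apply: (inj_on_card_le code) => // f g.
rewrite !inE => /= fB gB /(congr1 (fun h i => sval (h i))) /= fg.
apply/funext => i; have := congr1 (fun h => h i) fg => /=.
by do 2 (case: pselect => // ?); apply: psiI; rewrite inE.
Qed.

(** A set of size less than [ch] is the range of a function on some ordinal
    below [ch]; the functions on a fixed ordinal are counted by
    inaccessibility. *)
Lemma few_small_subsets {k ch a : O} :
  infinite_regular k -> ch < k -> lt_inaccessible ch k -> a < k ->
  few k (small_subsets ch a).
Proof.
move=> rk chk inacc ak.
pose range_of e (f : {i : O | i < e} -> O) := [set b | b < a /\ exists i, f i = b].
have [a' a'k aa'] := regular_unbounded rk _ ak.
pose F e := range_of e @` [set f | forall i, below a' (f i)].
have fF : few k (\bigcup_(e in below ch) F e).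
  apply: (regular_few_union rk (few_below chk)) => e ech.
  exact/few_image/(few_functions rk inacc ech)/few_below.
apply: (few_sub fF) => x [xa [e ech xe]]; exists e => //.
have [h hxe hI] := card_le_inj_on e xe.
(* [a] serves as the value of the enumeration where [h] has no preimage. *)
exists (fun i => xget a [set b | x b /\ h b = sval i]).
  by move=> i; case: xgetP => // b _ [/xa ba _]; exact: lt_trans ba aa'.
apply/seteqP; split=> [b [ba [i]]|b xb].
  by case: xgetP => [_ -> [xc _] <-//|_ ab]; rewrite ab ltxx in ba.
split; first exact: xa.
exists (exist (fun i => i < e) _ (hxe _ xb)) => /=; apply: xget_unique => // c [xc hcb].
by apply: hI; rewrite ?inE.
Qed.

Lemma few_labelled_small_subsets {k ch th a : O} :
  infinite_regular k -> ch < k -> lt_inaccessible ch k -> th < k -> a < k ->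
  few k [set w : O * set O | w.1 < th /\ small_subsets ch a w.2].
Proof.
move=> rk chk inacc thk ak.
have : few k (\bigcup_(m in below th) (pair m @` small_subsets ch a)).
  apply: (regular_few_union rk (few_below thk)) => m _.
  exact/few_image/few_small_subsets.
by move=> /few_sub; apply => -[m x] [/= mth xa]; exists m => //; exists x.
Qed.

(** * Homogeneous sets *)

Section Coloring.
Context {k th ch : O} {c : O -> O -> O} {h : O -> O}.
Hypotheses (rk : infinite_regular k).
Hypotheses (thch : th <= ch) (chk : ch < k) (inacc : lt_inaccessible ch k).
Hypotheses (closed_c : closed_coloring k th c) (subadd_c : subadditive k c).

Lemma subadd_trans {a b e m : O} : a < b -> b < e -> e < k ->
  c a b <= m -> c b e <= m -> c a e <= m.
Proof.
move=> ab be ek abm bem; have [/le_trans + _] := subadd_c _ _ _ ab be ek.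
by apply; rewrite ge_max abm.
Qed.

Lemma subadd_below {a b e m : O} : a < b -> b < e -> e < k ->
  c a e <= m -> c b e <= m -> c a b <= m.
Proof.
move=> ab be ek abm bem; have [_ /le_trans] := subadd_c _ _ _ ab be ek.
by apply; rewrite ge_max abm.
Qed.

(** The set of [a < b] with [c a b <= m] may be unbounded below a point [g < b]
    without any element above [g], in which case closedness says nothing about
    [g].  A point [b' > b] with [c b b' <= m] excludes this: the corresponding
    set for [b'] contains [b]. *)
Lemma color_limit {b b' m g : O} : b < b' -> b' < k -> c b b' <= m -> m < th ->
  g <= b -> below g !=set0 ->
  (forall e, e < g -> exists a, [/\ c a b <= m, e < a & a < g]) ->
  c g b' <= m.
Proof.
move=> bb' b'k cbb' mth gb g0 gcof.
suff : accp (Dle c m b') g by move/(closed_c _ _ b'k (ltW mth)) => -[].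
apply: (cofinal_accp (s := b') (b := b)) => //; first by move=> e [].
move=> e /gcof[a [cab ea ag]]; exists a; split=> //.
have ab := lt_le_trans ag gb.
by split; [exact: lt_trans ab bb'|exact: subadd_trans ab bb' b'k cab cbb'].
Qed.

(** Equivalently, [m < max (c a b) (h b)] for all [a < b] in [x]. *)
Definition homogeneous (m : O) (x : set O) : Prop :=
  forall a b, x a -> x b -> a < b -> h b <= m -> m < c a b.

Lemma homogeneous_sub {m : O} {x y : set O} :
  homogeneous m x -> y `<=` x -> homogeneous m y.
Proof. by move=> hx yx a b /yx xa /yx xb; exact: hx. Qed.

Definition bounded_at (m e : O) : Prop := forall b, e <= b -> b < k -> h b <= m ->
  exists2 e', e' < e & forall a, a < e -> c a b <= m -> a <= e'.

Hypothesis h_next :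
  forall b, b < k -> exists b', [/\ b < b', b' < k & c b b' <= h b].

Lemma bounded_max {m e b a0 : O} : m < th -> bounded_at m e ->
  e <= b -> b < k -> h b <= m -> a0 < e -> c a0 b <= m ->
  exists g, [/\ g < e, c g b <= m & forall a, a < e -> c a b <= m -> a <= g].
Proof.
move=> mth bnd eb bk hb a0e ca0.
have [e' e'e ub] := bnd b eb bk hb.
have [g gub gmin] := ex_least
  [set t | forall a, a < e -> c a b <= m -> a <= t] (ex_intro _ e' ub).
have ge : g < e by exact: le_lt_trans (gmin _ ub) e'e.
exists g; split=> //; rewrite leNgt; apply/negP => mcg.
have gcof z : z < g -> exists a, [/\ c a b <= m, z < a & a < g].
  move=> zg; apply: contrapT => Na; suff : g <= z by rewrite leNgt zg.
  apply: gmin => a ae cab; rewrite leNgt; apply/negP => za.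
  apply: Na; exists a; split=> //; rewrite lt_neqAle gub// andbT.
  by apply/eqP => ag; rewrite -ag ltNge cab in mcg.
have g0 : below g !=set0.
  exists a0; rewrite /below/= lt_neqAle gub// andbT.
  by apply/eqP => ag; rewrite -ag ltNge ca0 in mcg.
have [b' [bb' b'k cb]] := h_next _ bk.
have cbm := le_trans cb hb; have gb := lt_le_trans ge eb.
have := color_limit bb' b'k cbm mth (ltW gb) g0 gcof.
move=> /(subadd_below gb bb' b'k)/(_ cbm).
by rewrite leNgt mcg.
Qed.

Definition condition (m : O) (x : set O) : Prop :=
  [/\ x `<=` below k, few ch x & homogeneous m x].

(** An [m]-homogeneous set containing [x] contains no [a] below an element [g]
    of [G] with [c a g <= m], nor [g] itself: by subadditivity [c a b <= m] for
    the [b] that catches [g]. *)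
Definition catches (m : O) (G x : set O) : Prop :=
  forall g, G g -> exists b, [/\ x b, g < b, c g b <= m & h b <= m].

Definition reflecting (r : O -> O) : Prop :=
  forall a m y G x, a < k -> m < th -> small_subsets ch a y ->
    small_subsets ch a G -> condition m x -> y `<=` x -> catches m G x ->
    exists x', [/\ condition m x', y `<=` x', catches m G x' & x' `<=` below (r a)].

(** There are fewer than [k] triples [(m, y, G)] below a given ordinal, so one
    function bounds witnesses for all of them. *)
Lemma ex_reflecting :
  exists r : O -> O, (forall a, a < k -> r a < k) /\ reflecting r.
Proof.
have [ik _ cofk] := rk; have thk := le_lt_trans thch chk.
have [o ok] := infinite_setN0 ik.
have /choice[f fP] : forall w : (O * set O) * set O, exists b, b < k /\
    forall x, condition w.1.1 x -> w.1.2 `<=` x -> catches w.1.1 w.2 x ->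
    exists x', [/\ condition w.1.1 x', w.1.2 `<=` x', catches w.1.1 w.2 x' &
      x' `<=` below b].
  move=> [[m y] G] /=; have [[x [cx yx Gx]]|Nx] := pselect (exists x,
    [/\ condition m x, y `<=` x & catches m G x]); last first.
    by exists o; split=> // x cx yx Gx; case: Nx; exists x.
  have [xk fx _] := cx.
  have [b bk xb] := cof_bound id cofk (few_mono (ltW chk) fx) xk.
  by exists b; split=> // ? _ _ _; exists x.
have boundG (aw : O * (O * set O)) : exists b, aw.1 < k -> b < k /\
    forall G, small_subsets ch aw.1 G -> f (aw.2, G) < b.
  have [ak|] := pselect (aw.1 < k); last by exists o.
  have [|b bk fb] := cof_bound (fun G => f (aw.2, G)) cofk
    (few_small_subsets rk chk inacc ak); last by exists b.
  by move=> G _; case: (fP (aw.2, G)).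
have [fG fGP] := choice boundG.
have boundw a : exists b, a < k -> b < k /\
    forall w, w.1 < th -> small_subsets ch a w.2 -> fG (a, w) < b.
  have [ak|] := pselect (a < k); last by exists o.
  have [|b bk fb] := cof_bound (fun w => fG (a, w)) cofk
    (few_labelled_small_subsets rk chk inacc thk ak).
    by move=> w _; have [] := fGP (a, w) ak.
  by exists b => _; split=> // w wth wa; exact: fb.
have [r rP] := choice boundw.
exists r; split=> [a /rP[]//|a m y G x ak mth ya Ga cx yx Gx].
have [_ H] := fP ((m, y), G); have [x' [? ? ? x'f]] := H x cx yx Gx.
exists x'; split=> // b /x'f bf; apply: lt_trans bf _.
have [_ /(_ _ Ga) fr] := fGP (a, (m, y)) ak; apply: lt_trans fr _.
by have [_ /(_ (m, y) mth ya)] := rP a ak.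
Qed.

(** The points below [e] that an element [b >= e] of [x] excludes are bounded by
    their maximum [g] and related to it.  The set [x'] reflects [x] below [e]
    and catches all these [g], so homogeneous sets containing [x'] avoid every
    excluded point. *)
Lemma condition_reduction {r : O -> O} {e m : O} {x : set O} :
  reflecting r -> e < k -> is_cof e ch -> closed_under r e -> m < th -> bounded_at m e ->
  condition m x ->
  exists x', [/\ condition m x', x' `<=` below e &
    forall z, z `<=` below e -> homogeneous m z -> x' `<=` z ->
      homogeneous m (z `|` x)].
Proof.
move=> rP ek cofe [e0 re] mth bnd cx; have [xk fx hx] := cx.
pose top b g := [/\ g < e, c g b <= m & forall a, a < e -> c a b <= m -> a <= g].
pose y := [set b | x b /\ b < e].
pose G := [set g | exists b, [/\ x b, e <= b, h b <= m & top b g]].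
have fy : few ch y by apply: few_sub fx _ => b [].
have fG : few ch G.
  apply: few_sub (few_image (fun b => xget b (top b)) fx) _.
  move=> g [b [xb eb hb tg]]; exists b => //; apply: xget_unique => //.
  move=> g' [g'e cg' g'max]; have [ge cg gmax] := tg.
  by apply/le_anti; rewrite gmax// g'max.
have [a1 a1e ya1] := cof_bound id cofe fy (fun b => @proj2 _ _).
have [|a2 a2e Ga2] := cof_bound id cofe fG; first by move=> g [b [_ _ _ []]].
pose a := Order.max a1 a2.
have ae : a < e by rewrite gt_max a1e.
have yx : y `<=` x by move=> b [].
have Gx : catches m G x.
  move=> g [b [xb eb hb [ge cg _]]]; exists b; split=> //.
  exact: lt_le_trans ge eb.
have [||x' [cx' yx' Gx' x'r]] := rP a m y G x (lt_trans ae ek) mth _ _ cx yx Gx.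
- by split=> // b yb; rewrite /below/= lt_max ya1.
- by split=> // g Gg; rewrite /below/= lt_max Ga2 ?orbT.
exists x'; split=> //; first by move=> b /x'r br; exact: lt_trans br (re _ ae).
move=> z ze hz x'z a' b [za|xa] [zb|xb] a'b hb; first exact: hz.
- have [be|eb] := ltP b e; first by apply: hz => //; apply/x'z/yx'.
  rewrite ltNge; apply/negP => cab.
  have a'e := ze _ za.
  have [g [ge cg gmax]] := bounded_max mth bnd eb (xk _ xb) hb a'e cab.
  have [b' [x'b' gb' cgb' hb']] := Gx' g (ex_intro _ b (And4 xb eb hb (And3 ge cg gmax))).
  have a'g := gmax _ a'e cab.
  have zb' := x'z _ x'b'; have b'k := lt_trans (ze _ zb') ek.
  have := hz a' b' za zb' (le_lt_trans a'g gb') hb'; rewrite ltNge => /negP; apply.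
  move: a'g; rewrite le_eqVlt => /predU1P[->//|a'g].
  have gb := lt_le_trans ge eb.
  exact: subadd_trans a'g gb' b'k (subadd_below a'g gb (xk _ xb) cab cg) cgb'.
- apply: hz => //; apply/x'z/yx'; split=> //.
  exact: lt_trans a'b (ze _ zb).
- exact: hx.
Qed.

End Coloring.
End WellOrder.

Arguments homogeneous {d O} c h m x.
Arguments condition {d O} k ch c h m x.
Arguments bounded_at {d O} k c h m e.
Arguments reflecting {d O} k th ch c h r.

(** * Regular suborders *)

(** [q] is a reduction of [p] to [Q] when every extension of [q] in [Q] is
    compatible with [p].  An element [p] incompatible with a maximal antichain
    of [Q] would have a reduction incompatible with it inside [Q]. *)
Lemma regular_suborder_reduction {dp : Order.disp_t} {P : porderType dp}
    {Q : set P} :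
  (forall p q, Q p -> Q q -> compatible setT p q -> compatible Q p q) ->
  (forall p, exists2 q, Q q & forall r, Q r -> r <= q -> compatible setT r p) ->
  regular_suborder Q.
Proof.
move=> Qcompat Qred; split=> [p q Qp Qq NQ /(Qcompat _ _ Qp Qq)//|A].
move=> [[AQ Aanti] Amax]; split; first split=> // p q Ap Aq pq.
  by move=> /(Qcompat _ _ (AQ _ Ap) (AQ _ Aq)); exact: Aanti.
move=> B [_ Banti] AB; apply/seteqP; split=> // p Bp.
apply: contrapT => NAp; have [q Qq qred] := Qred p.
have q_incompat a : A a -> ~ compatible Q q a.
  move=> Aa [r [Qr rq ra]]; have [s [_ sr sp]] := qred r Qr rq.
  apply: (Banti a p (AB _ Aa) Bp); first by move=> ap; apply: NAp; rewrite -ap.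
  by exists s; split=> //; exact: le_trans sr ra.
have Aq : A q.
  rewrite -(Amax (A `|` [set q])); [by right| |by left].
  split=> [a [/AQ//|->//]|a b [Aa|->] [Ab|->]//].
  - exact: Aanti.
  - move=> _ [r [Qr ra rq]]; apply: (q_incompat a) => //; by exists r.
  - by move=> _; exact: q_incompat.
by apply: (q_incompat q Aq); exists q.
Qed.

(** * The posets of homogeneous sets *)

Section Conditions.
Context {d : Order.disp_t} {O : orderType d}.
Context (k ch : O) (c : O -> O -> O) (h : O -> O).

(** The disjoint union, over the labels [m] in [I], of the posets of
    [m]-homogeneous sets. *)
Definition conditions (I : set O) : Type :=
  {w : O * set O | `[< I w.1 /\ condition k ch c h w.1 w.2 >]}.

Section Order.
Context {I : set O}.
Implicit Types p q r : conditions I.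

HB.instance Definition _ :=
  Choice.copy (conditions I)
    {w : O * set O | `[< I w.1 /\ condition k ch c h w.1 w.2 >]}.

Definition label p : O := (sval p).1.
Definition support p : set O := (sval p).2.

Lemma label_in p : I (label p).
Proof. by have /asboolP[] := svalP p. Qed.

Lemma support_condition p : condition k ch c h (label p) (support p).
Proof. by have /asboolP[] := svalP p. Qed.

Lemma condition_ext p q : label p = label q -> support p = support q -> p = q.
Proof.
move: p q => [[m x] px] [[n y] py]; rewrite /label /support /= => mn xy.
by subst; congr exist; exact: Prop_irrelevance.
Qed.

Definition Condition m x (Im : I m) (mx : condition k ch c h m x) : conditions I :=
  exist _ (m, x) (asboolT (conj Im mx)).

Definition condition_le p q : bool :=
  (label p == label q) && `[< support q `<=` support p >].

Fact condition_le_refl : reflexive condition_le.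
Proof. by move=> p; rewrite /condition_le eqxx; apply/asboolP. Qed.

Fact condition_le_anti : antisymmetric condition_le.
Proof.
move=> p q /andP[/andP[/eqP pq /asboolP qp] /andP[_ /asboolP qp']].
by apply: condition_ext => //; apply/seteqP.
Qed.

Fact condition_le_trans : transitive condition_le.
Proof.
move=> q p r /andP[/eqP pq /asboolP qp] /andP[/eqP qr /asboolP rq].
rewrite /condition_le pq qr eqxx; apply/asboolP; exact: subset_trans rq qp.
Qed.

HB.instance Definition _ := Order.Le_isPOrder.Build (Order.Disp tt tt)
  (conditions I) condition_le_refl condition_le_anti condition_le_trans.

Lemma condition_leP p q :
  p <= q <-> label p = label q /\ support q `<=` support p.
Proof.
by split=> [/andP[/eqP ? /asboolP ?]//|[pq qp]];
   apply/andP; split; [exact/eqP|exact/asboolP].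
Qed.

Lemma condition_infimum (D : set (conditions I)) (p : conditions I) :
  (forall q, D q -> label p = label q) ->
  support p = \bigcup_(q in D) support q -> D !=set0 -> infimums D p.
Proof.
move=> Dlab psupp [q0 Dq0]; split=> [q Dq|q qlb]; apply/condition_leP; split.
- exact: Dlab.
- by rewrite psupp => b qb; exists q.
- have /condition_leP[-> _] := qlb _ Dq0; by rewrite (Dlab _ Dq0).
- rewrite psupp => b [q' /qlb /condition_leP[_ +] q'b]; exact.
Qed.

End Order.
End Conditions.

Arguments label {d O k ch c h I} p.
Arguments support {d O k ch c h I} p.
Arguments label_in {d O k ch c h I} p.
Arguments support_condition {d O k ch c h I} p.
Arguments Condition {d O k ch c h I m x}.
Arguments condition_ext {d O k ch c h I} p q.
Arguments condition_leP {d O k ch c h I p q}.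
Arguments condition_infimum {d O k ch c h I}.

Section Posets.
Context {d : Order.disp_t} {O : orderType d}.
Hypothesis wfO : well_founded (fun a b : O => a < b).
Context {k th ch : O} {c : O -> O -> O} {h : O -> O}.
Hypotheses (rk : infinite_regular k) (rch : infinite_regular ch).
Hypotheses (thch : th <= ch) (chk : ch < k) (inacc : lt_inaccessible ch k).
Hypotheses (closed_c : closed_coloring k th c) (subadd_c : subadditive k c).
Hypothesis color_c : coloring k th c.
Hypothesis h_next :
  forall b, b < k -> exists b', [/\ b < b', b' < k & c b b' <= h b].
Hypothesis h_lt : forall b, b < k -> h b < th.

Local Notation cond := (conditions k ch c h).

Lemma well_met_conditions (I : set O) : well_met (cond I).
Proof.
move=> p q [r [_ /condition_leP[rp pr] /condition_leP[rq qr]]].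
have [_ _ hr] := support_condition r.
have [pk pf _] := support_condition p; have [qk qf _] := support_condition q.
have pq : condition k ch c h (label p) (support p `|` support q).
  split; first by move=> b [/pk|/qk].
    exact: regular_few_setU.
  by rewrite -rp; apply: homogeneous_sub hr _ => b [/pr|/qr].
exists (Condition (label_in p) pq); apply: condition_infimum.
- by move=> s [->|->] //; exact: etrans (esym rp) rq.
- apply/seteqP; split=> [b [pb|qb]|b [s [->|->] sb]].
  + by exists p => //; left.
  + by exists q => //; right.
  + by left.
  + by right.
- by exists p; left.
Qed.

Lemma directed_closed_conditions (I : set O) : directed_closed_glb ch (cond I).
Proof.
move=> D [D0 dirD] Dch; have [p0 Dp0] := D0; have [_ cch _] := rch.
have fD : few ch D by apply/(few_card_lt wfO cch).
have lab p : D p -> label p0 = label p.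
  move=> Dp; have [r [_ /condition_leP[<- _] /condition_leP[<- _]]] := dirD _ _ Dp0 Dp.
  by [].
have cU : condition k ch c h (label p0) (\bigcup_(p in D) support p).
  split.
  - by move=> b [p _ pb]; have [pk _ _] := support_condition p; exact: pk.
  - apply: regular_few_union => // p _; by have [] := support_condition p.
  - move=> a b [p Dp pa] [q Dq qb].
    have [r [Dr /condition_leP[_ pr] /condition_leP[_ qr]]] := dirD _ _ Dp Dq.
    have [_ _] := support_condition r; rewrite -(lab _ Dr); apply.
      exact: pr.
    exact: qr.
by exists (Condition (label_in p0) cU); exact: condition_infimum.
Qed.

Section Product.
Context {I : O -> set O}.
Local Notation P := (fun i => cond (I i) : porderType _).

(** Singletons [{a}] and [{b}] with [a < b] are incompatible at the coordinate
    whose label is the larger of [c a b] and [h b]. *)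
Lemma product_not_cc : (forall i, i < th -> I i i) ->
  ~ has_cc k (product_below P th).
Proof.
move=> Iii; apply; have [ik _ _] := rk; have [ich _ _] := rch.
have single m a : condition k ch c h m [set b | b = a /\ b < k].
  split=> [b []//||b e [-> _] [-> _]]; last by rewrite ltxx.
  apply: few_sub (infinite_few_finite wfO ich (finite_set1 a)) _.
  by move=> b [].
pose f a : product_below P th := fun i => Condition (Iii _ (svalP i)) (single _ a).
have f_incompat a b : a < b -> b < k -> ~ compatible setT (f a) (f b).
  move=> ab bk [r [_ /asboolP ra /asboolP rb]].
  have mth : Order.max (c a b) (h b) < th.
    by rewrite gt_max h_lt// andbT; exact: color_c.
  set m := Order.max _ _ in mth.
  have /condition_leP[lab sa] := ra (exist _ m mth).
  have /condition_leP[_ sb] := rb (exist _ m mth).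
  have [_ _] := support_condition (r (exist _ m mth)); rewrite lab => hom.
  have : m < c a b.
    apply: hom => //; last by rewrite /m le_max lexx orbT.
      by apply: sa; split=> //; exact: lt_trans ab bk.
    exact: sb.
  by rewrite ltNge le_max lexx.
have f_inj : set_inj (below k) f.
  move=> a b; rewrite !inE => ak bk fab; case: (ltgtP a b) => // [ab|ba].
    by case: (f_incompat _ _ ab bk); rewrite fab; exists (f b).
  by case: (f_incompat _ _ ba ak); rewrite fab; exists (f b).
exists (f @` below k); split; last exact: inj_card_eq.
split=> // _ _ [a ak <-] [b bk <-] fab; case: (ltgtP a b) => [ab|ba|ab].
- exact: f_incompat.
- by move=> [r [? ? ?]]; apply: (f_incompat _ _ ba ak); exists r.
- by case: fab; rewrite ab.
Qed.

Context {j : O}.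
Hypothesis jth : j < th.
Hypothesis I_lt : forall i, i < j -> I i `<=` below th.

Definition supported (e : O) : set (product_below P j) :=
  [set p | forall i, support (p i) `<=` below e].

Lemma few_supported {e : O} : e < k -> few k (supported e).
Proof.
move=> ek; have jch := lt_le_trans jth thch; have thk := le_lt_trans thch chk.
apply: few_le (few_functions wfO rk inacc jch
  (few_labelled_small_subsets wfO rk chk inacc thk ek)) _.
apply: (inj_on_card_le (fun (p : product_below P j) i => sval (p i))).
  move=> p pe i; split; first by apply: (I_lt _ (svalP i)); exact: label_in.
  by split; [exact: pe|case: (support_condition (p i))].
move=> p q _ _ pq; apply: functional_extensionality_dep => i.
have pqi : sval (p i) = sval (q i) by exact: (congr1 (fun f => f i) pq).
by apply: condition_ext; rewrite /label /support pqi.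
Qed.

Lemma supported_bounded {e b : O} {p : product_below P j} :
  ch <= b -> is_cof e b -> supported e p -> exists2 a, a < e & supported a p.
Proof.
move=> chb cofe pe; have jch := lt_le_trans jth thch.
have fU : few ch (\bigcup_(i in [set: {i | i < j}]) support (p i)).
  apply: regular_few_union => // [|i _]; last by case: (support_condition (p i)).
  apply: few_le (few_below jch) _; apply: (inj_on_card_le sval) => [i _|].
    exact: (svalP i).
  by move=> i i' _ _; exact: val_inj.
have [|a ae pa] := cof_bound id cofe (few_mono chb fU).
  by move=> a [i _ /pe].
by exists a => // i a' ia'; apply: pa; exists i.
Qed.

Lemma regular_supported {r : O -> O} {e : O} :
  reflecting k th ch c h r ->
  e < k -> is_cof e ch -> closed_under r e ->
  (forall i m, i < j -> I i m -> bounded_at k c h m e) ->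
  regular_suborder (supported e).
Proof.
move=> rP ek cofe re bnd; apply: regular_suborder_reduction => [p q pe qe|p].
  move=> [s [_ /asboolP sp /asboolP sq]].
  have trace i : condition k ch c h (label (s i)) (support (s i) `&` below e).
    have [sk sf sh] := support_condition (s i); split.
    - by move=> b [/sk].
    - by apply: few_sub sf _ => b [].
    - by apply: homogeneous_sub sh _ => b [].
  pose t : product_below P j := fun i => Condition (label_in (s i)) (trace i).
  exists t; split; first by move=> i b [].
  - apply/asboolP => i; have /condition_leP[l1 l2] := sp i.
    by apply/condition_leP; split=> // b pb; split; [exact: l2|exact: pe pb].
  - apply/asboolP => i; have /condition_leP[l1 l2] := sq i.
    by apply/condition_leP; split=> // b qb; split; [exact: l2|exact: qe qb].
have red (i : {i | i < j}) : exists x', [/\ condition k ch c h (label (p i)) x',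
    x' `<=` below e & forall z, z `<=` below e ->
    homogeneous c h (label (p i)) z -> x' `<=` z ->
    homogeneous c h (label (p i)) (z `|` support (p i))].
  have Ii := label_in (p i).
  apply: (condition_reduction wfO closed_c subadd_c h_next rP ek cofe re) => //.
  - exact: I_lt (svalP i) _ Ii.
  - exact: bnd (svalP i) Ii.
  - exact: support_condition.
have [x xP] := choice red.
have cx i : condition k ch c h (label (p i)) (x i) by case: (xP i).
exists (fun i => Condition (label_in (p i)) (cx i)).
  by move=> i; case: (xP i).
move=> s se /asboolP sx.
have cs i : condition k ch c h (label (p i)) (support (s i) `|` support (p i)).
  have [_ _ hom] := xP i; have /condition_leP[l1 l2] := sx i.
  have [sk sf sh] := support_condition (s i).
  have [pk pf _] := support_condition (p i).
  split; first by move=> b [/sk|/pk].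
    exact: regular_few_setU.
  by apply: hom => //; move: sh; rewrite l1.
exists (fun i => Condition (label_in (p i)) (cs i)); split=> //.
  apply/asboolP => i; have /condition_leP[l1 _] := sx i.
  by apply/condition_leP; split=> // b; left.
by apply/asboolP => i; apply/condition_leP; split=> // b; right.
Qed.

(** A club of small subsets of the product contains the union of an
    increasing chain [Z] interleaved with the suborders [supported a]; at a
    closure point [e] of cofinality [ch] this union is [supported e], because
    conditions have support of size less than [ch]. *)
Lemma stationarily_layered_product :
  (forall g, (forall a, a < k -> g a < k) -> exists e, [/\ e < k, is_cof e ch,
    closed_under g e & forall i m, i < j -> I i m -> bounded_at k c h m e]) ->
  stationarily_layered k (product_below P j).
Proof.
move=> stat; have [ik ck cofk] := rk; split=> [Q []//|CC [CCsub CCcof CCchain]].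
have [o ok] := infinite_setN0 ik.
have supp_k (p : product_below P j) : supported k p.
  by move=> i; case: (support_condition (p i)).
have [Z ZE] := wf_recursion wfO (fun (a : O) (prev : forall b, b < a -> _) =>
  xget set0 [set Y | [/\ CC Y, supported a `<=` Y &
                      forall b (ba : b < a), prev b ba `<=` Y]]).
have ZP a : a < k ->
    [/\ CC (Z a), supported a `<=` Z a & forall b, b < a -> Z b `<=` Z a].
  elim/(well_founded_ind wfO): a => a IH ak.
  rewrite [Z a]ZE; apply: (@xgetPex _ set0 [set Y | [/\ CC Y, supported a `<=` Y &
    forall b (ba : b < a), Z b `<=` Y]]).
  have [|Y CCY YU] := CCcof (supported a `|` \bigcup_(b in below a) Z b).
    apply/(few_card_lt wfO ck); apply: (regular_few_setU wfO rk (few_supported ak)).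
    apply: (regular_few_union wfO rk (few_below ak)) => b ba.
    by have [/CCsub/(few_card_lt wfO ck)] := IH b ba (lt_trans ba ak).
  by exists Y; split=> // [p pa|b ba p bp]; apply: YU; [left|right; exists b].
have bound a : exists b, a < k -> b < k /\ Z a `<=` supported b.
  have [ak|] := pselect (a < k); last by exists o.
  have fZ : few k (Z a).
    by have [/CCsub/(few_card_lt wfO ck)] := ZP a ak.
  have /choice[f fP] (p : product_below P j) : exists b, b < k /\ supported b p.
    by have [b bk pb] := supported_bounded (ltW chk) cofk (supp_k p); exists b.
  have [|b bk fb] := cof_bound f cofk fZ; first by move=> p _; case: (fP p).
  exists b => _; split=> // p Zp i b' ib; have [_ pf] := fP p.
  exact: lt_trans (pf i _ ib) (fb _ Zp).
have [g gP] := choice bound.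
have [r [rk' rP]] := ex_reflecting wfO rk thch chk inacc (c := c) (h := h).
have [|e [ek cofe /closed_under_max[ge re] bnd]] :=
  stat (fun a => Order.max (g a) (r a)).
  by move=> a ak; rewrite gt_max rk' // andbT; case: (gP a ak).
have [e0 eg] := ge.
exists (supported e); split; last first.
  split; last exact/(few_card_lt wfO ck)/few_supported.
  exact: regular_supported rP ek cofe re bnd.
suff -> : supported e = \bigcup_(a in below e) Z a.
  apply: CCchain => // [a ae|a a' aa' a'e].
    by case: (ZP a (lt_trans ae ek)).
  move: aa'; rewrite le_eqVlt => /predU1P[->//|aa'].
  by case: (ZP a' (lt_trans a'e ek)) => _ _; exact.
apply/seteqP; split=> p.
  move=> /(supported_bounded (lexx ch) cofe)[a ae pa]; exists a => //.
  by case: (ZP a (lt_trans ae ek)) => _ + _; exact.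
move=> [a ae /(proj2 (gP a (lt_trans ae ek)))] pg i b /pg bg.
exact: lt_trans bg (eg _ ae).
Qed.

End Product.

Lemma layered_conditions (I : O -> set O) :
  (forall i, i < th -> I i i) -> (forall i, i < th -> I i `<=` below th) ->
  (forall j g, j < th -> (forall a, a < k -> g a < k) ->
    exists e, [/\ e < k, is_cof e ch, closed_under g e &
      forall i m, i < j -> I i m -> bounded_at k c h m e]) ->
  layered_sequence k th ch (fun i => cond (I i) : porderType _).
Proof.
move=> Iii Ilt stat; split; last exact: product_not_cc.
- move=> i _; split; [exact: well_met_conditions|exact: directed_closed_conditions].
- move=> j jth; apply: stationarily_layered_product => //.
    by move=> i ij; apply: Ilt; exact: lt_trans ij jth.
  by move=> g; exact: stat.
Qed.

End Posets.

(** * Colors that are large on stationary many ordinals *)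

Section LargeColor.
Context {d : Order.disp_t} {O : orderType d}.
Hypothesis wfO : well_founded (fun a b : O => a < b).
Context {two k th ch : O} {c : O -> O -> O}.
Hypothesis two_def : is_nat_ordinal two 2.
Hypotheses (rk : infinite_regular k) (rch : infinite_regular ch).
Hypotheses (thch : th <= ch) (chk : ch < k).
Hypotheses (subadd_c : subadditive k c) (U_c : U_witness k two th two c).

(** The least element [z] of [two] and the next one [o] stand for 0 and 1. *)
Lemma ordinal_one : exists z o, [/\ z < o, o < two & below o = [set z]].
Proof.
have : `I_2 #<= below two by move: two_def => /card_esym; rewrite card_eq_le => /andP[].
move=> /(card_le_inj_on two)[f f2 fI].
have f01 : f 0%N <> f 1%N by move/fI; rewrite !inE => /(_ isT isT).
have [z z2 zmin] := ex_least wfO (below two) (ex_intro _ (f 0%N) (f2 0%N isT)).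
have [|o [o2 zo] omin] := ex_least wfO [set b | below two b /\ b != z].
  have [f0z|f0z] := eqVneq (f 0%N) z; last by exists (f 0%N); split=> //; exact: f2.
  exists (f 1%N); split; first exact: f2.
  by apply/eqP => f1z; apply: f01; rewrite f0z f1z.
exists z, o; split=> //; first by rewrite lt_neqAle eq_sym zo zmin.
apply/seteqP; split=> [b bo|_ ->]; last by rewrite /below/= lt_neqAle eq_sym zo zmin.
apply: contrapT => /eqP bz; have := omin b (conj (lt_trans bo o2) bz).
by rewrite leNgt bo.
Qed.

(** The instance of [U_witness] for families of singletons. *)
Lemma unbounded_color {A : set O} {i : O} : A `<=` below k -> below k #<= A ->
  i < th -> exists a b, [/\ A a, A b, a < b & i < c a b].
Proof.
move=> Ak kA ith; have [z [o [zo otwo below_o]]] := ordinal_one.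
have ztwo := lt_trans zo otwo.
have [_ /(_ o (set1 @` A) i otwo)] := U_c; case=> //.
- move=> _ [a Aa <-]; split; first by move=> b ->; exact: Ak.
  by rewrite below_o; exact: eq_card1.
- by move=> _ _ [a Aa <-] [b Ab <-] [e [/= -> ->]].
- apply: (card_eq_trans (inj_card_eq _)).
    by move=> a b _ _ /seteqP[/(_ a erefl)].
  by rewrite card_eq_le kA andbT; exact: subset_card_le.
move=> BB [BA BB2 BBc].
have [f fB fI] : exists2 f, set_fun (below two) BB f & set_inj (below two) f.
  by apply: (card_le_inj_on set0); move: BB2; rewrite card_eq_le => /andP[].
have [a Aa fz] := BA _ (fB z ztwo); have [b Ab fo] := BA _ (fB o otwo).
have Ba : BB [set a] by rewrite fz; exact: fB.
have Bb : BB [set b] by rewrite fo; exact: fB.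
case: (ltgtP a b) => [ab|ba|ab].
- exists a, b; split=> //; apply: (BBc _ _ Ba Bb) => // _ _ -> -> //.
- exists b, a; split=> //; apply: (BBc _ _ Bb Ba) => // _ _ -> -> //.
- have : f z = f o by rewrite -fz -fo ab.
  move/fI; rewrite !inE => /(_ ztwo otwo) zo'; by rewrite zo' ltxx in zo.
Qed.

(** Otherwise every [b] has a color [i] such that [c b a <= i] at all closure
    points [a] of cofinality [ch] of some function.  The same [i] serves for
    [k] many [b], and by subadditivity [c] is then bounded by [i] on these. *)
Lemma ex_large_color : exists2 b, b < k &
  forall i g, i < th -> (forall a, a < k -> g a < k) ->
  exists a, [/\ a < k, is_cof a ch, closed_under g a, b < a & i < c b a].
Proof.
have [_ _ cofk] := rk.
apply: contrapT => Nb.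
have /choice[w wP] : forall b, exists w : O * (O -> O), b < k ->
    [/\ w.1 < th, forall a, a < k -> w.2 a < k & forall a, a < k -> is_cof a ch ->
      closed_under w.2 a -> b < a -> c b a <= w.1].
  move=> b; apply: contrapT => Nw; apply: Nb; exists b.
    by apply: contrapT => bk; apply: Nw; exists (b, id) => /bk.
  move=> i g ith gk; apply: contrapT => Na; apply: Nw; exists (i, g) => bk.
  split=> // a ak acof ga ba; rewrite leNgt; apply/negP => ic; apply: Na.
  by exists a.
pose A i := [set b | b < k /\ (w b).1 = i].
have [i ith kA] : exists2 i, i < th & below k #<= A i.
  apply: contrapT => Ni.
  have : few k (\bigcup_(i in below th) A i).
    apply: (regular_few_union wfO rk (few_below (le_lt_trans thch chk))) => i ith.
    by case: (card_dichotomy wfO k (A i)) => // kA; case: Ni; exists i.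
  have [_ ck _] := rk.
  move=> /(few_card_lt wfO ck)[_]; apply; apply: subset_card_le => b bk.
  by exists (w b).1 => //; case: (wP b bk).
have [|a [b [[ak wa] [bk wb] ab ic]]] := unbounded_color _ kA ith.
  by move=> b [].
have [_ gak ha] := wP a ak; have [_ gbk hb] := wP b bk.
have [|e [ek be cofe /closed_under_max[gae gbe]]] := ex_closed_under wfO
    (g := fun z => Order.max ((w a).2 z) ((w b).2 z)) rk rch chk _ bk.
  by move=> z zk; rewrite gt_max gak ?gbk.
have ae := lt_trans ab be.
have cae := ha e ek cofe gae ae; have cbe := hb e ek cofe gbe be.
rewrite wa in cae; rewrite wb in cbe.
by have := subadd_below subadd_c ab be ek cae cbe; rewrite leNgt ic.
Qed.

End LargeColor.

(** * Layered sequences of posets *)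

Theorem theoremD (d : Order.disp_t) (O : orderType d)
  (wfO : well_founded (fun a b : O => a < b))
  (two kappa theta chi : O) (c : O -> O -> O)
  (two_def : is_nat_ordinal two 2)
  (reg_kappa : infinite_regular kappa)
  (reg_theta : infinite_regular theta)
  (reg_chi : infinite_regular chi)
  (theta_chi : theta <= chi) (chi_kappa : chi < kappa)
  (inacc : lt_inaccessible chi kappa)
  (closed_c : closed_coloring kappa theta c)
  (subadd_c : subadditive kappa c)
  (U_c : U_witness kappa two theta two c) :
  (exists (dp : Order.disp_t) (P : O -> porderType dp),
     layered_sequence kappa theta chi P) /\
  (stationary kappa (partial kappa theta c `&` cof_set kappa chi) ->
   exists (dp : Order.disp_t) (Q : porderType dp),
     layered_sequence kappa theta chi (fun _ : O => Q)).
Proof.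
have [color_c _] := U_c.
have /choice[next nextP] : forall b, exists b', b < kappa -> b' < kappa /\ b < b'.
  move=> b; have [bk|] := pselect (b < kappa); last by exists b.
  by have [b' ? ?] := regular_unbounded wfO reg_kappa _ bk; exists b'.
split.
- have [b0 b0k large] := ex_large_color wfO two_def reg_kappa reg_chi theta_chi
    chi_kappa subadd_c U_c.
  pose h b := if b0 < b then Order.max (c b (next b)) (c b0 b) else c b (next b).
  exists (Order.Disp tt tt), (fun i => conditions kappa chi c h [set i]).
  apply: (layered_conditions wfO reg_kappa reg_chi theta_chi chi_kappa inacc
    closed_c subadd_c color_c _ _ (set1)) => //.
  + move=> b bk; exists (next b); have [nk bn] := nextP b bk; split=> //.
    by rewrite /h; case: ifP => // _; rewrite le_max lexx.
  + move=> b bk; have [nk bn] := nextP b bk.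
    rewrite /h; case: ifP => [b0b|_]; last exact: color_c.
    by rewrite gt_max !color_c.
  + by move=> i ith _ ->.
  move=> j g jth gk; have [e [ek cofe ge b0e jc]] := large j g jth gk.
  exists e; split=> // i m ij /= -> {m} b eb bk; rewrite /h (lt_le_trans b0e eb).
  rewrite ge_max => /andP[cnext cb0].
  have [nk bn] := nextP b bk.
  (* If the colors [<= i] were cofinal below [e], then [c e (next b) <= i] by
     closedness, and subadditivity would bring [c b0 e] down to [i]. *)
  apply: contrapT => Nbnd; suff : c b0 e <= i.
    by rewrite leNgt (lt_trans ij jc).
  have cen : c e (next b) <= i.
    apply: (color_limit wfO closed_c subadd_c bn nk cnext (lt_trans ij jth) eb).
      by exists b0.
    move=> z ze; apply: contrapT => Nz; apply: Nbnd; exists z => // a ae cab.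
    by rewrite leNgt; apply/negP => za; apply: Nz; exists a.
  have b0b := lt_le_trans b0e eb; have en := le_lt_trans eb bn.
  apply: (subadd_below subadd_c b0e en nk _ cen).
  exact: (subadd_trans subadd_c b0b bn nk cb0 cnext).
- move=> stat; pose h b := c b (next b).
  exists (Order.Disp tt tt), (conditions kappa chi c h (below theta)).
  apply: (layered_conditions wfO reg_kappa reg_chi theta_chi chi_kappa inacc
    closed_c subadd_c color_c _ _ (fun=> below theta)) => //.
  + by move=> b bk; have [nk bn] := nextP b bk; exists (next b).
  + by move=> b bk; have [nk bn] := nextP b bk; exact: color_c.
  + by move=> i _ b.
  move=> j g jth gk.
  have [e [[[_ eP] [_ cofe]] ek ge]] :=
    stationary_closed_under wfO reg_kappa reg_chi chi_kappa stat gk.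
  exists e; split=> // i m _ mth b eb bk _.
  have [s [sub _] se] := eP b m bk mth.
  by exists s => // a ae cab; apply: sub; split=> //; split=> //; exact: lt_le_trans eb.
Qed.
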